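(* Let $n$ be a positive integer. Define a double-indexed sequence $W_r(k)$ (integers $r\ge 0$, $k\ge 0$) by $W_r(0)=1$ for all $r$ and, for $k\ge 1$, $$W_r(k)=3\,(n-r-k)\,W_r(k-1)-2\,(n-2r-\delta(n-1))\,W_{r+1}(k-1).$$ Then $$\frac{W_0(\lfloor n/2\rfloor)}{(n-1)(n-2)\cdots(n-\lfloor n/2\rfloor)}=\begin{cases}+2 & n\equiv 0 \pmod{12}\\ +1 & n\equiv\pm1,\pm2\pmod{12}\\ 0 & n\equiv\pm3\pmod{12}\\ -1 & n\equiv\pm4,\pm5\pmod{12}\\ -2 & n\equiv \pm 6\pmod{12}.\end{cases}$$
   Context: For an integer $m\ge 0$, $\delta(m)\in\{0,1\}$ is the residue of $m$ modulo $2$. The denominator is $\prod_{j=1}^{\lfloor n/2\rfloor}(n-j)$; an empty product equals $1$. *)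

(* Defs.v *)
From mathcomp Require Import all_boot all_order all_algebra.
Set Implicit Arguments.
Unset Strict Implicit.
Unset Printing Implicit Defensive.
Import Order.TTheory GRing.Theory Num.Theory.
Local Open Scope ring_scope.

Definition delta (m : nat) : nat := (m %% 2)%N.

(* The sequence is integer-valued, with signed subtraction in both factors;    *)
(* n.-1 inside delta is the true predecessor since n is taken positive.        *)
Fixpoint W (n r k : nat) {struct k} : int :=
  match k with
  | 0 => 1
  | k'.+1 =>
      3 * (n%:Z - r%:Z - k%:Z) * W n r k'
      - 2 * (n%:Z - 2 * r%:Z - (delta n.-1)%:Z) * W n r.+1 k'
  end.

Definition W_ratio (n : nat) : rat :=
  (W n 0 n./2)%:~R / \prod_(1 <= j < n./2.+1) (n%:R - j%:R).

Definition cong_pm12 (n a : nat) : bool :=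
  (n%:Z == a%:Z %[mod 12])%Z || (n%:Z == - a%:Z %[mod 12])%Z.

(* Main.v *)
Require Import Defs.
From mathcomp Require Import all_boot all_order all_algebra.
From mathcomp Require Import zify ring.
Set Implicit Arguments.
Unset Strict Implicit.
Unset Printing Implicit Defensive.
Import Order.TTheory GRing.Theory Num.Theory.
Local Open Scope ring_scope.

(** Unfolding the recurrence writes [W n r k] as a sum over lattice paths: each
    of the [k] steps either keeps [r], with weight [3 (n - r - k)], or raises
    it, with weight [-2 (n - 2 r - delta (n - 1))].  Raising [r] while lowering
    [k] leaves [r + k] unchanged, so the weights of the first kind depend only
    on how many such steps came before, not on where the other steps are
    inserted; the weights of the second kind depend on [r] alone.  All paths
    with [i] raising steps thus have the same weight, and [W] is a single
    binomial sum ([W_closed]).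

    Put [m = floor (n / 2)].  At [r = 0], [k = m] the [i]-th summand, divided
    by [(n - 1) ... (n - m)], is [(-1)^i l(n, i) 3^(m - i)], where
    [l(n, i) = n / (n - i) * C(n - i, i)] is the coefficient in
    [x^n + y^n = \sum_i (-1)^i l(n, i) (x y)^i (x + y)^(n - 2 i)].
    The key is that [2^i m (m - 1) ... (m - i + 1)] supplies the factors of
    [n (n - 1) ... (n - 2 i + 1)] missing from the product of the raising
    weights ([fall2_ffact], [fact_lucas_coef]).

    The ratio is therefore [x^n + y^n] at [x + y = sqrt 3], [x y = 1], divided
    by [sqrt 3] when [n] is odd.  There [x] and [y] are the primitive twelfth
    roots of unity [exp (+- i pi / 6)], which explains the period 12.  To stay
    within the integers, the proof uses the analogous sum [chebU], which is
    [(x^(n+1) - y^(n+1)) / (x - y)] up to the same normalization.  Its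
    three-term recurrence comes from the rule of Pascal, and
    [x^2 + y^2 = 1] becomes [chebU (n + 4) = chebU (n + 2) - chebU n], whence
    [chebU (n + 6) = - chebU n].  The ratio is exactly [chebU (n + 2)], and
    it remains to tabulate one period. *)

(** * The recurrence as a binomial sum *)

Definition rise (a : int) (k : nat) : int := \prod_(t < k) (a + t%:Z).

Definition fall2 (a : int) (k : nat) : int := \prod_(s < k) (a - 2 * s%:Z).

Lemma riseS a k : rise a k.+1 = a * rise (a + 1) k.
Proof.
rewrite /rise big_ord_recl /= addr0; congr (_ * _).
by apply: eq_bigr => t _; rewrite /bump /=; lia.
Qed.

Lemma fall2S a k : fall2 a k.+1 = a * fall2 (a - 2) k.
Proof.
rewrite /fall2 big_ord_recl /= mulr0 subr0; congr (_ * _).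
by apply: eq_bigr => s _; rewrite /bump /=; lia.
Qed.

Lemma fall2Sr a k : fall2 a k.+1 = fall2 a k * (a - 2 * k%:Z).
Proof. exact: big_ord_recr. Qed.

(** The rule of Pascal inside a binomial sum: it splits the paths of length
    [k + 1] according to their first step. *)
Lemma sum_binS (R : pzSemiRingType) (F : nat -> R) k :
  \sum_(i < k.+2) 'C(k.+1, i)%:R * F i =
    \sum_(i < k.+1) 'C(k, i)%:R * F i + \sum_(i < k.+1) 'C(k, i)%:R * F i.+1.
Proof.
rewrite big_ord_recl [X in X + _ = _]/= bin0.
under eq_bigr => i _ do rewrite /bump /= binS natrD mulrDl.
rewrite big_split /= addrA; congr (_ + _).
rewrite big_ord_recr /= bin_small // mul0r addr0.
by rewrite [RHS]big_ord_recl bin0.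
Qed.

(** Here [i] counts the steps that raise [r].  Neither product depends on the
    order of the two kinds of steps, hence the bare factor ['C(k, i)]. *)
Lemma W_closed n r k :
  W n r k = \sum_(i < k.+1) 'C(k, i)%:R *
    ((-2) ^+ i * 3 ^+ (k - i) * fall2 (n%:Z - 2 * r%:Z - (delta n.-1)%:Z) i
     * rise (n%:Z - r%:Z - k%:Z) (k - i)).
Proof.
elim: k r => [|k IHk] r.
  by rewrite big_ord_recl big_ord0 /= /fall2 /rise !big_ord0.
rewrite (sum_binS (fun i => (-2) ^+ i * 3 ^+ (k.+1 - i)
    * fall2 (n%:Z - 2 * r%:Z - (delta n.-1)%:Z) i
    * rise (n%:Z - r%:Z - k.+1%:Z) (k.+1 - i))).
rewrite [LHS]/= !IHk !mulr_sumr -sumrN; congr (_ + _); apply: eq_bigr => i _.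
  rewrite (subSn (leq_ord i)) exprS riseS.
  have -> : n%:Z - r%:Z - k.+1%:Z + 1 = n%:Z - r%:Z - k%:Z by lia.
  by ring.
rewrite subSS exprS fall2S.
have -> : n%:Z - 2 * r.+1%:Z - (delta n.-1)%:Z
        = n%:Z - 2 * r%:Z - (delta n.-1)%:Z - 2 by lia.
have -> : n%:Z - r.+1%:Z - k%:Z = n%:Z - r%:Z - k.+1%:Z by lia.
by ring.
Qed.

(** * Falling factorials and the coefficients of Lucas polynomials *)

Lemma rise_ffact a k : rise (a.+1%:Z - k%:Z) k = (a ^_ k)%:R.
Proof.
elim: k => [|k IHk]; first by rewrite /rise big_ord0.
rewrite riseS (_ : _ + 1 = a.+1%:Z - k%:Z); last by lia.
rewrite IHk ffactnSr natrM mulrC.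
have [le_ka|lt_ak] := leqP k a; last by rewrite ffact_small ?mul0r.
by congr (_ * _); rewrite natrB // !natz; lia.
Qed.

Lemma ffactnD n i j : (n ^_ (i + j) = n ^_ i * (n - i) ^_ j)%N.
Proof.
elim: j => [|j IHj]; first by rewrite addn0 muln1.
by rewrite addnS !ffactnSr IHj subnDA mulnA.
Qed.

(** The step-two product consists of the odd factors of [n ^_ i.*2], since
    [n - delta n.-1] is the odd one of [n] and [n.-1]; the even factors are
    the [2 * (n./2 - s)] with [s < i]. *)
Lemma fall2_ffact n i : (0 < n)%N ->
  2 ^+ i * (n./2 ^_ i)%:R * fall2 (n%:Z - (delta n.-1)%:Z) i
    = (n ^_ i.*2)%:R.
Proof.
move=> n_gt0; elim: i => [|i IHi]; first by rewrite /fall2 big_ord0.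
rewrite fall2Sr exprS doubleS !ffactnSr !natrM -IHi.
have [le_in|lt_ni] := leqP i n./2; last first.
  by rewrite (ffact_small lt_ni); ring.
(* The two new factors are [2 * d] and its odd neighbour. *)
have [d Dm]: {d | n./2 = (i + d)%N} by exists (n./2 - i)%N; rewrite subnKC.
have Dn: n = (odd n + (i + d).*2)%N by rewrite -Dm odd_double_half.
have Edelta : delta n.-1 = ~~ odd n.
  rewrite /delta modn2; case: n n_gt0 {IHi le_in Dm Dn} => //= n _.
  by rewrite negbK.
have -> : (n./2 - i = d)%N by rewrite Dm addKn.
have -> : (n - i.*2 = odd n + d.*2)%N by lia.
have -> : (n - i.*2.+1 = (odd n + d.*2).-1)%N by lia.
have E : 2 * d%:R * (n%:Z - (delta n.-1)%:Z - 2 * i%:Z)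
    = (odd n + d.*2)%:R * (odd n + d.*2).-1%:R.
  rewrite Edelta !natz.
  by case: (odd n) Dn => /= Dn; rewrite {1}Dn; case: (d) => [|e]; lia.
rewrite -[RHS]mulrA -E; ring.
Qed.

(** The integer [n / (n - i) * 'C(n - i, i)], as a sum of two binomials in
    order to avoid the division. *)
Definition lucas_coef (n i : nat) : nat :=
  'C(n - i, i) + (if i is j.+1 then 'C(n - i.+1, j) else 0%N).

(** For [i > 0], [i`!] times either binomial is a multiple of
    [(n - i - 1) ^_ i.-1]; the cofactors [n - i] and [i] add up to [n], and this
    [n] completes [n.-1 ^_ i] to the head of [n ^_ i.*2]. *)
Lemma fact_lucas_coef n i : (0 < n)%N -> (i.*2 <= n)%N ->
  (i`! * (lucas_coef n i * n.-1 ^_ i) = n ^_ i.*2)%N.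
Proof.
case: n => // n _; case: i => [|i] le_in; first by rewrite /lucas_coef bin0.
have -> : i.+1.*2 = (i.+2 + i)%N by lia.
rewrite ffactnD ffactSS succnK subSS mulnA [RHS]mulnAC; congr (_ * _)%N.
have E1 : (i.+1`! * 'C(n - i, i.+1) = (n - i) * (n - i.+1) ^_ i)%N.
  by rewrite mulnC bin_ffact ffactnS subnS.
have E2 : (i.+1`! * 'C(n - i.+1, i) = i.+1 * (n - i.+1) ^_ i)%N.
  by rewrite factS -mulnA [(i`! * _)%N]mulnC bin_ffact.
rewrite /lucas_coef !subSS mulnDr E1 E2 -mulnDl; congr (_ * _)%N; lia.
Qed.

(** * A Chebyshev-type sum of period twelve *)

(** The Chebyshev polynomial of the second kind at [sqrt 3 / 2], that is
    [sin ((n + 1) pi / 6) / sin (pi / 6)], divided by [sqrt 3] for odd [n]. *)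
Definition chebU (n : nat) : int :=
  \sum_(i < n./2.+1) (-1) ^+ i * 'C(n - i, i)%:R * 3 ^+ (n./2 - i).

(** Summation up to bounds that do not depend on the parity of [n] makes the
    sums of consecutive indices comparable term by term. *)
Lemma chebU_widen n N : (n./2 < N)%N ->
  chebU n = \sum_(i < N) (-1) ^+ i * 'C(n - i, i)%:R * 3 ^+ (n./2 - i).
Proof.
move=> lt_nN; rewrite /chebU.
rewrite (big_ord_widen N
  (fun i => (-1) ^+ i * 'C(n - i, i)%:R * 3 ^+ (n./2 - i)) lt_nN).
rewrite [RHS](bigID (fun i : 'I_N => (i < n./2.+1)%N)) /=.
rewrite [X in _ = _ + X]big1 ?addr0 //.
by move=> i lt_ni; rewrite bin_small ?mulr0 ?mul0r //; lia.
Qed.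

(** Before normalization the coefficient is [sqrt 3] for every [n]; dividing the
    odd-indexed values by [sqrt 3] turns it into [1] or [3]. *)
Lemma chebUS2 n :
  chebU n.+2 = (if odd n then 1 else 3) * chebU n.+1 - chebU n.
Proof.
rewrite (@chebU_widen n.+2 n.+2); last by lia.
rewrite (@chebU_widen n.+1 n.+2); last by lia.
rewrite (@chebU_widen n n.+1); last by lia.
rewrite !(big_ord_recl n.+1) /= mulrDr -addrA; congr (_ + _).
  rewrite !bin0 !subn0 !expr0 !mul1r uphalf_half.
  by case: (odd n); rewrite ?mul1r // -exprS.
rewrite mulr_sumr -sumrB; apply: eq_bigr => i _; rewrite /bump /= !add1n !subSS.
have le_in : (i <= n)%N := leq_ord i.
rewrite subSn // binS natrD exprS uphalf_half.
have [lt_ni|le_ni] := ltnP (n - i) i.+1.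
  by rewrite bin_small // add0r mulr0 mul0r mulr0 sub0r; ring.
case En: (odd n); first by rewrite add1n subSS; ring.
have -> : (n./2 - i = (0 + n./2 - i.+1).+1)%N by lia.
by rewrite exprS; ring.
Qed.

(** Of two consecutive coefficients in [chebUS2] one is [1] and the other [3],
    so elimination of [chebU (n + 1)] and [chebU (n + 3)] gives a relation
    that does not depend on the parity of [n]. *)
Lemma chebUD4 n : chebU (n + 4) = chebU (n + 2) - chebU n.
Proof.
rewrite !addnS addn0 !chebUS2 /=; case: (odd n); rewrite /=; ring.
Qed.

Lemma chebUD6 n : chebU (n + 6) = - chebU n.
Proof.
have -> : (n + 6 = n + 2 + 4)%N by lia.
rewrite chebUD4 -addnA chebUD4; ring.
Qed.

Lemma chebU_mod12 n : chebU n = chebU (n %% 12).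
Proof.
rewrite {1}(divn_eq n 12); elim: (n %/ 12)%N => // q <-.
have -> : (q.+1 * 12 + n %% 12 = q * 12 + n %% 12 + 6 + 6)%N by lia.
by rewrite !chebUD6 opprK.
Qed.

(** * The value of the ratio *)

(** The two binomials in [lucas_coef] give [chebU n - chebU (n - 2)], which the
    two-step recurrence turns into [chebU (n + 2)]; this last form also covers
    [n = 1], where [n - 2] is negative. *)
Lemma sum_lucas_coef n : (0 < n)%N ->
  \sum_(i < n./2.+1) (-1) ^+ i * (lucas_coef n i)%:R * 3 ^+ (n./2 - i)
    = chebU n.+2.
Proof.
case: n => [|[|k]] // _.
  by rewrite /chebU !big_ord_recl !big_ord0.
have -> : chebU k.+4 = chebU k.+2 - chebU k.
  by rewrite -[k.+4]addn4 chebUD4 addn2.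
rewrite [chebU k.+2]/chebU /chebU !(big_ord_recl k./2.+1) /=.
rewrite -addrA; congr (_ + _); rewrite -sumrB; apply: eq_bigr => i _.
rewrite /bump /= !add1n /lucas_coef !subSS natrD exprS; ring.
Qed.

(** The product of the weights that keep [r] is the tail
    [(n.-1 - i) ^_ (n./2 - i)] of the denominator, and the remaining factors of
    the summand produce its head times the Lucas coefficient. *)
Lemma W0_half n : (0 < n)%N ->
  W n 0 n./2 = (n.-1 ^_ n./2)%:R * chebU n.+2.
Proof.
move=> n_gt0; rewrite W_closed -sum_lucas_coef // mulr_sumr.
apply: eq_bigr => i _; have le_im : (i <= n./2)%N := leq_ord i.
have key : 'C(n./2, i)%:R * (2 ^+ i * fall2 (n%:Z - (delta n.-1)%:Z) i)
    = (lucas_coef n i)%:R * (n.-1 ^_ i)%:R.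
  have fact_neq0 : i`!%:R != 0 :> int by rewrite pnatr_eq0 -lt0n fact_gt0.
  apply: (mulfI fact_neq0); rewrite -!natrM fact_lucas_coef //; last by lia.
  by rewrite -fall2_ffact // -bin_ffact natrM; ring.
rewrite mulr0 !subr0.
have -> : n%:Z - n./2%:Z = (n.-1 - i).+1%:Z - (n./2 - i)%N%:Z by lia.
have -> : (n.-1 ^_ n./2 = n.-1 ^_ i * (n.-1 - i) ^_ (n./2 - i))%N.
  by rewrite -ffactnD subnKC.
rewrite rise_ffact natrM -[-2]mulN1r exprMn.
transitivity ((-1) ^+ i * 3 ^+ (n./2 - i) * ((n.-1 - i) ^_ (n./2 - i))%:R
  * ('C(n./2, i)%:R * (2 ^+ i * fall2 (n%:Z - (delta n.-1)%:Z) i))).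
  by ring.
by rewrite key; ring.
Qed.

Lemma W_ratioE n : (0 < n)%N -> W_ratio n = (chebU n.+2)%:~R.
Proof.
move=> n_gt0; rewrite /W_ratio W0_half //.
have -> : \prod_(1 <= j < n./2.+1) (n%:R - j%:R) = (n.-1 ^_ n./2)%:R :> rat.
  rewrite big_add1 big_mkord ffact_prod natr_prod; apply: eq_bigr => i _.
  have lt_im := ltn_ord i.
  rewrite -natrB; last by lia.
  by rewrite subnS predn_sub.
rewrite rmorphM /= rmorph_nat mulrAC divff ?mul1r //.
by rewrite pnatr_eq0 -lt0n ffact_gt0; lia.
Qed.

Theorem theorem5 (n : nat) (hn : (0 < n)%N) :
  [/\ (n%:Z == 0 %[mod 12])%Z -> W_ratio n = 2,
      cong_pm12 n 1 || cong_pm12 n 2 -> W_ratio n = 1,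
      cong_pm12 n 3 -> W_ratio n = 0,
      cong_pm12 n 4 || cong_pm12 n 5 -> W_ratio n = - 1
    & cong_pm12 n 6 -> W_ratio n = - 2].
Proof.
rewrite W_ratioE // chebU_mod12 -[n.+2]addn2 -modnDml /cong_pm12.
have lt_r : (n %% 12 < 12)%N by rewrite ltn_mod.
have U0 : chebU 0 = 1 by rewrite /chebU big_ord_recl big_ord0.
have U1 : chebU 1 = 1 by rewrite /chebU big_ord_recl big_ord0.
have -> : chebU ((n %% 12 + 2) %% 12)
    = nth 0 [:: 2; 1; 1; 0; -1; -1; -2; -1; -1; 0; 1; 1] (n %% 12).
  move: (n %% 12)%N lt_r.
  by do 12?[case=> [|]] => // _; rewrite ?(chebUS2, U0, U1).
split=> Hn.
- by have -> : (n %% 12 = 0)%N by lia.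
- have : (n %% 12 \in [:: 1; 2; 10; 11])%N by rewrite !inE; lia.
  by rewrite !inE => /or4P[] /eqP->.
- have /orP[] : (n %% 12 == 3)%N || (n %% 12 == 9)%N by lia.
    by move/eqP->.
  by move/eqP->.
- have : (n %% 12 \in [:: 4; 5; 7; 8])%N by rewrite !inE; lia.
  by rewrite !inE => /or4P[] /eqP->.
- by have -> : (n %% 12 = 6)%N by lia.
Qed.
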